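(* Let $(X,G,W)$ be a convex $G$-metric space with a convex structure $W$, and let $T:X\to X$ be a mapping with a fixed point $u$ satisfying $$G(Tx,Ty,Tz)\le a\,G(x,y,z)+b\max\{G(x,Tx,Tx),\,G(y,Ty,Ty),\,G(z,Tz,Tz)\}$$ for all $x,y,z\in X$, where $a,b$ are nonnegative real numbers with $0<a+3b<1$. Let $x_0\in X$, let $\{\alpha_n\}_{n\ge 0}\subset[0,1]$ satisfy $\sum_{n=0}^{\infty}\alpha_n=\infty$, and let $\{x_n\}$ be the Mann iterative process defined by $$x_{n+1}=W(x_n,Tx_n;1-\alpha_n,\alpha_n),\qquad n=0,1,2,\dots.$$ Then $\{x_n\}$ converges strongly to a fixed point of $T$.
   Context: A $G$-metric space is a pair $(X,G)$ where $X$ is a nonempty set and $G:X\times X\times X\to[0,\infty)$ satisfies: (i) $G(x,y,z)=0$ if $x=y=z$; (ii) $0<G(x,x,y)$ for all $x,y\in X$ with $x\ne y$; (iii) $G(x,x,y)\le G(x,y,z)$ for all $x,y,z\in X$ with $z\ne y$; (iv) $G$ is symmetric in all three variables; (v) $G(x,y,z)\le G(x,a,a)+G(a,y,z)$ for all $x,y,z,a\in X$. A convex structure on a $G$-metric space $(X,G)$ is a mapping $W:X^2\times I^2\to X$, with $I=[0,1]$, such that $G(W(x,y;\lambda,\beta),u,v)\le\lambda G(x,u,v)+\beta G(y,u,v)$ for all $x,y,u,v\in X$ and all $\lambda,\beta\in I$ with $\lambda+\beta=1$. The triple $(X,G,W)$ is then called a convex $G$-metric space. A sequence $\{x_n\}$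 in $X$ converges (strongly, i.e. $G$-converges) to $x\in X$ if $\lim_{n,m\to\infty}G(x,x_n,x_m)=0$; equivalently, $G(x_n,x,x)\to0$ as $n\to\infty$. *)

(* Defs.v *)
(* Library: MathComp-Analysis; [R : realType] is the field of real numbers. *)
From HB Require Import structures.
From mathcomp Require Import all_boot all_order all_algebra.
From mathcomp Require Import all_classical all_reals all_analysis.
Set Implicit Arguments.
Unset Strict Implicit.
Unset Printing Implicit Defensive.
Import Order.TTheory GRing.Theory Num.Theory.
Import numFieldNormedType.Exports.
Local Open Scope classical_set_scope.
Local Open Scope ring_scope.

Record Gmetric_space (R : realType) (X : Type) (G : X -> X -> X -> R) : Prop := {
  Gmetric_nonempty : inhabited X;
  Gmetric_ge0 : forall x y z, 0 <= G x y z;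
  Gmetric_refl : forall x, G x x x = 0;
  Gmetric_gt0 : forall x y, x <> y -> 0 < G x x y;
  Gmetric_le : forall x y z, z <> y -> G x x y <= G x y z;
  (* the two adjacent transpositions generate all permutations of (x, y, z) *)
  Gmetric_symC12 : forall x y z, G x y z = G y x z;
  Gmetric_symC23 : forall x y z, G x y z = G x z y;
  Gmetric_rectangle : forall x y z a, G x y z <= G x a a + G a y z }.

(* A map defined on X^2 * [0,1]^2 is represented by a total map on
   X^2 * R^2, whose values outside [0,1]^2 are unconstrained. *)
Definition convex_structure (R : realType) (X : Type) (G : X -> X -> X -> R)
    (W : X -> X -> R -> R -> X) : Prop :=
  forall (x y u v : X) (lambda beta : R),
    0 <= lambda <= 1 -> 0 <= beta <= 1 -> lambda + beta = 1 ->
    G (W x y lambda beta) u v <= lambda * G x u v + beta * G y u v.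

Record convex_Gmetric_space (R : realType) (X : Type) (G : X -> X -> X -> R)
    (W : X -> X -> R -> R -> X) : Prop := {
  convex_Gmetric : Gmetric_space G;
  convex_Gmetric_structure : convex_structure G W }.

Definition Gconverges (R : realType) (X : Type) (G : X -> X -> X -> R)
    (x_ : nat -> X) (x : X) : Prop :=
  G x (x_ nm.1) (x_ nm.2) @[nm --> (\oo, \oo)] --> (0 : R).

Definition mann_iteration (R : realType) (X : Type)
    (W : X -> X -> R -> R -> X) (T : X -> X) (alpha : nat -> R)
    (x0 : X) (x_ : nat -> X) : Prop :=
  x_ 0%N = x0 /\
  forall n, x_ n.+1 = W (x_ n) (T (x_ n)) (1 - alpha n) (alpha n).

(* Main.v *)
Require Import Defs.
From HB Require Import structures.
From mathcomp Require Import all_boot all_order all_algebra.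
From mathcomp Require Import all_classical all_reals all_analysis.
From mathcomp Require Import ring lra.
Import Order.TTheory GRing.Theory Num.Theory.
Import numFieldNormedType.Exports.
Local Open Scope classical_set_scope.
Local Open Scope ring_scope.

(** Measure the distance to the given fixed point [u] by [d n = G (x_ n) u u].
    Applying the contractive condition to the triple [(x, u, u)] bounds
    [G (T x) u u] by [a * G x u u + b * G x (T x) (T x)], and two uses of the
    rectangle inequality bound [G x (T x) (T x)] by
    [G x u u + 2 * G (T x) u u].  Hence [T] contracts distances to [u] by the
    factor [q = (a + b) / (1 - 2 * b)], and [q < 1] is exactly the condition
    [a + 3 * b < 1] ([contraction_to_fixed_point]).

    Convexity of [G] along [W] turns one Mann step into
    [d n.+1 <= (1 - (1 - q) * alpha n) * d n].  Since
    [(1 - t) * (1 + s + t) <= 1 + s], the quantity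
    [d n * (1 + (1 - q) * \sum_(k < n) alpha k)] does not increase
    ([damped_le]), so the divergence of the series forces [d] to tend to [0]
    ([damped_cvg0]).  Finally [G u (x_ n) (x_ m) <= d n + d m], so the
    double limit is [0] and [x_] converges to [u] itself. *)

Lemma Gmetric_swap_le (R : realType) (X : Type) (G : X -> X -> X -> R)
    (hG : Gmetric_space G) (x y : X) : G x y y <= 2 * G y x x.
Proof.
have := Gmetric_rectangle hG y y x x.
rewrite (Gmetric_symC23 hG y y x) (Gmetric_symC12 hG y x y).
by rewrite (Gmetric_symC12 hG x y x); lra.
Qed.

Lemma Gmetric_le_pair (R : realType) (X : Type) (G : X -> X -> X -> R)
    (hG : Gmetric_space G) (u x y : X) : G u x y <= G x u u + G y u u.
Proof.
rewrite (Gmetric_symC12 hG u x y).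
apply: le_trans (Gmetric_rectangle hG x u y u) _.
by rewrite (Gmetric_symC23 hG u u y) (Gmetric_symC12 hG u y u).
Qed.

(** With [e = G (T x) u u] and [d = G x u u], the contractive condition at
    [(x, u, u)] reads [e <= a * d + b * (d + 2 * e)]; solving for [e] gives the
    factor. *)
Lemma contraction_to_fixed_point (R : realType) (X : Type)
    (G : X -> X -> X -> R) (hG : Gmetric_space G) (T : X -> X) (u : X)
    (hu : T u = u) (a b : R) (hb : 0 <= b) (hb2 : 2 * b < 1)
    (hT : forall x y z : X,
       G (T x) (T y) (T z) <=
         a * G x y z +
         b * Num.max (G x (T x) (T x))
               (Num.max (G y (T y) (T y)) (G z (T z) (T z)))) (x : X) :
  G (T x) u u <= (a + b) / (1 - 2 * b) * G x u u.
Proof.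
have := hT x u u.
rewrite hu (Gmetric_refl hG u) maxxx max_l ?(Gmetric_ge0 hG) // => hTx.
have hx : G x (T x) (T x) <= G x u u + 2 * G (T x) u u.
  apply: le_trans (Gmetric_rectangle hG x (T x) (T x) u) _.
  by rewrite lerD2l; exact: Gmetric_swap_le.
have hbx := ler_wpM2l hb hx.
by rewrite mulrAC ler_pdivlMr ?subr_gt0 //; nra.
Qed.

(** [(1 - t) * (1 + s + t) = (1 + s) - t * (s + t)] with [t = c * alpha n]: the
    growth of the weight is paid for by the decrease of [d]. *)
Lemma damped_le (R : realFieldType) (c : R) (alpha d : nat -> R)
    (hc : 0 <= c) (halpha : forall n, 0 <= alpha n)
    (hd0 : forall n, 0 <= d n)
    (hd : forall n, d n.+1 <= (1 - c * alpha n) * d n) (n : nat) :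
  d n * (1 + c * \sum_(0 <= k < n) alpha k) <= d 0%N.
Proof.
elim: n => [|n IHn]; first by rewrite big_geq // mulr0 addr0 mulr1.
apply: le_trans IHn; rewrite big_nat_recr //=.
set s := \sum_(0 <= k < n) alpha k.
have hs : 0 <= c * s by rewrite mulr_ge0 // sumr_ge0.
have ht : 0 <= c * alpha n by rewrite mulr_ge0.
rewrite [c * _]mulrDr; move: (c * s) (c * alpha n) hs ht (hd n) => r t hr ht hdn.
apply: (@le_trans _ _ ((1 - t) * d n * (1 + (r + t)))).
  by rewrite ler_wpM2r // !addr_ge0.
have -> : (1 - t) * d n * (1 + (r + t)) = d n * (1 + r) - d n * (t * (r + t)).
  by ring.
by rewrite gerBl !mulr_ge0 // addr_ge0.
Qed.

Lemma nneseries_pinfty_cvg (R : realType) (alpha : nat -> R)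
    (halpha : forall n, 0 <= alpha n)
    (hsum : (\sum_(0 <= n <oo) (alpha n)%:E)%E = +oo%E) :
  \sum_(0 <= k < n) alpha k @[n --> \oo] --> +oo.
Proof.
apply/cvgeryP; rewrite -hsum.
under eq_fun do rewrite -sumEFin.
by apply: is_cvg_nneseries => n _ _; rewrite lee_fin.
Qed.

(** An elementary substitute for the divergence to [0] of the infinite product
    of the factors [1 - c * alpha n]. *)
Lemma damped_cvg0 (R : realType) (c : R) (alpha d : nat -> R)
    (hc : 0 < c) (halpha : forall n, 0 <= alpha n)
    (hd0 : forall n, 0 <= d n)
    (hd : forall n, d n.+1 <= (1 - c * alpha n) * d n)
    (hsum : (\sum_(0 <= n <oo) (alpha n)%:E)%E = +oo%E) :
  d n @[n --> \oo] --> 0.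
Proof.
have hS := nneseries_pinfty_cvg _ _ halpha hsum.
apply/cvgr0Pnorm_le => e e0.
(* Once the partial sums exceed this value, [e < d n] would make the weighted
   distance exceed its initial value [d 0]. *)
move/cvgryPge : hS => /(_ (d 0%N / (c * e))) hS.
near=> n.
rewrite ger0_norm //.
have hn := damped_le _ c alpha d (ltW hc) halpha hd0 hd n.
have : d 0%N / (c * e) <= \sum_(0 <= k < n) alpha k by near: n; exact: hS.
rewrite ler_pdivrMr ?mulr_gt0 //.
move: (\sum_(0 <= k < n) alpha k) (sumr_ge0 (index_iota 0 n) (P := xpredT)
  (fun k _ => halpha k)) hn => s hs hn hse.
rewrite leNgt; apply/negP => hlt.
have hpos : 0 < 1 + c * s by rewrite ltr_wpDr // mulr_ge0 // ltW.
have : e * (1 + c * s) < d n * (1 + c * s) by rewrite ltr_pM2r.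
by nra.
Unshelve. all: by end_near. Qed.

Theorem corollary2p3 (R : realType) (X : Type) (G : X -> X -> X -> R)
    (W : X -> X -> R -> R -> X) (hX : convex_Gmetric_space G W)
    (T : X -> X) (u : X) (hu : T u = u) (a b : R)
    (ha : 0 <= a) (hb : 0 <= b) (hab : 0 < a + 3 * b < 1)
    (hT : forall x y z : X,
       G (T x) (T y) (T z) <=
         a * G x y z +
         b * Num.max (G x (T x) (T x))
               (Num.max (G y (T y) (T y)) (G z (T z) (T z))))
    (x0 : X) (alpha : nat -> R) (halpha : forall n, 0 <= alpha n <= 1)
    (hsum : (\sum_(0 <= n <oo) (alpha n)%:E)%E = +oo%E)
    (x_ : nat -> X) (hx : mann_iteration W T alpha x0 x_) :
  exists p : X, T p = p /\ Gconverges G x_ p.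
Proof.
exists u; split => //.
case: hX => hG hW; case: hx => _ hx.
have [_ hab1] := andP hab.
have hb2 : 2 * b < 1 by lra.
set q := (a + b) / (1 - 2 * b).
have hq : q < 1 by rewrite ltr_pdivrMr ?subr_gt0 //; lra.
have halpha0 n : 0 <= alpha n by have /andP[] := halpha n.
have hd : G (x_ n) u u @[n --> \oo] --> 0.
  apply: (damped_cvg0 R (1 - q) alpha) => // [||n]; rewrite ?subr_gt0 //.
    by move=> n; exact: Gmetric_ge0.
  have /andP[al0 al1] := halpha n.
  have hstep : G (x_ n.+1) u u <=
      (1 - alpha n) * G (x_ n) u u + alpha n * G (T (x_ n)) u u.
    by rewrite hx; apply: hW; rewrite ?subrK // ?al0 // subr_ge0 al1 gerBl.
  have hTn := ler_wpM2l al0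
    (contraction_to_fixed_point _ _ _ hG _ _ hu _ _ hb hb2 hT (x_ n)).
  by move: hstep hTn; rewrite -/q; lra.
apply/cvgr0Pnorm_le => e e0.
have he : \forall n \near \oo, G (x_ n) u u <= e / 2.
  move/cvgr0Pnorm_le : hd => /(_ (e / 2)); rewrite divr_gt0 // => /(_ isT).
  by apply: filterS => n; rewrite ger0_norm // (Gmetric_ge0 hG).
exists ([set n | G (x_ n) u u <= e / 2], [set n | G (x_ n) u u <= e / 2]) => //.
move=> [n m] /= [hn hm]; rewrite ger0_norm ?(Gmetric_ge0 hG) //.
apply: le_trans (Gmetric_le_pair _ _ _ hG u (x_ n) (x_ m)) _.
by rewrite [leRHS]splitr lerD.
Qed.
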